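(* Let $q\in\mathbb{R}$, $q\neq0$, and let $\alpha:I\subseteq\mathbb{R}\rightarrow\mathbb{R}^{2n+1}(-3)$, $\alpha=(\alpha_1,\dots,\alpha_n,\alpha_{n+1},\dots,\alpha_{2n},\alpha_{2n+1})$, be a pseudo-Hermitian magnetic curve (for the strength $q$) in $\mathbb{R}^{2n+1}(-3)$ endowed with the Tanaka-Webster connection, parametrized by arc-length $t$, with (constant) contact angle $\theta$, $\cos\theta=\eta(\alpha')$. Then the components of $\alpha$ satisfy either (a) for $i=1,\dots,n$, $$\alpha_i=\frac{c_i}{\lambda}\sin(\lambda t+d_i)+h_i,\qquad \alpha_{n+i}=\frac{-c_i}{\lambda}\cos(\lambda t+d_i)+h_{n+i},$$ $$\alpha_{2n+1}=2t\cos\theta+\sum_{i=1}^{n}\left\{\frac{-c_i^2}{4\lambda^2}\left[2(\lambda t+d_i)+\sin(2(\lambda t+d_i))\right]+\frac{c_ih_{n+i}}{\lambda}\sin(\lambda t+d_i)\right\}+h_{2n+1},$$ where $\lambda=q-2\cos\theta\neq0$ and $c_i,d_i$ $(i=1,\dots,n)$, $h_i$ $(i=1,\dots,2n+1)$ are arbitrary real constants such that $\sum_{i=1}^{n}c_i^2=4\sin^2\theta$; or (b) for $i=1,\dots,2n$, $$\alpha_i=c_it+d_i,$$ $$\alpha_{2n+1}=2t\cos\theta+\sum_{i=1}^{n}c_i\left(\frac{c_{n+i}}{2}t^2+d_{n+i}t\right)+c_{2n+1},$$ where $q=2\cos\theta$ and $c_i$ $(i=1,\dots,2n+1)$, $d_i$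 $(i=1,\dots,2n)$ are arbitrary real constants such that $q^2+\sum_{i=1}^{2n}c_i^2=4$.
   Context: The Sasakian space form $\mathbb{R}^{2n+1}(-3)$ is $\mathbb{R}^{2n+1}$ with coordinates $(x_1,\dots,x_n,y_1,\dots,y_n,z)$ and the structure $\eta=\frac12\left(dz-\sum_{i=1}^n y_i\,dx_i\right)$, $\xi=2\frac{\partial}{\partial z}$, $g=\eta\otimes\eta+\frac14\sum_{i=1}^n\left((dx_i)^2+(dy_i)^2\right)$, and $\phi$ the $(1,1)$-tensor field with $\phi\frac{\partial}{\partial x_i}=-\frac{\partial}{\partial y_i}$, $\phi\frac{\partial}{\partial y_i}=\frac{\partial}{\partial x_i}+y_i\frac{\partial}{\partial z}$, $\phi\frac{\partial}{\partial z}=0$. Its Tanaka-Webster connection is $$\widehat{\nabla}_XY=\nabla_XY+\eta(X)\phi Y+\eta(Y)\phi X-g(\phi X,Y)\xi,$$ where $\nabla$ is the Levi-Civita connection of $g$. Equivalently, $\widehat{\nabla}$ is the connection for which the vector fields $X_i=2\frac{\partial}{\partial y_i}$, $X_{n+i}=\phi X_i=2\left(\frac{\partial}{\partial x_i}+y_i\frac{\partial}{\partial z}\right)$ $(i=1,\dots,n)$ and $\xi$, which form a $g$-orthonormal frame, are parallel. A unit-speed curve $\alpha$ with $E_1=\alpha'$ is pseudo-Hermitian magnetic for the contact magnetic field $F_q(X,Y)=q\,g(X,\phi Y)$ of strength $q\neq0$ if $\widehat{\nabla}_{E_1}E_1=[-q+2\eta(E_1)]\phi E_1$. For such a curve $\eta(E_1)$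 is constant; its contact angle $\theta\in[0,\pi]$ is defined by $\cos\theta=\eta(E_1)$. *)

(* Defs.v *)
From HB Require Import structures.
From mathcomp Require Import all_boot all_order all_algebra.
From mathcomp Require Import all_classical all_reals all_analysis.
Import Order.TTheory GRing.Theory Num.Theory.
Import numFieldNormedType.Exports.

Set Implicit Arguments.
Unset Strict Implicit.
Unset Printing Implicit Defensive.

Local Open Scope classical_set_scope.
Local Open Scope ring_scope.

(* Points and tangent vectors of R^(2n+1) are both row vectors: a tangent
   vector v at p is the family of its coefficients on the coordinate fields
   d/dx_1, .., d/dx_n, d/dy_1, .., d/dy_n, d/dz. *)
Section Coordinates.
Context {n : nat}.

Definition ix (i : 'I_n) : 'I_(n + n + 1) := lshift 1 (lshift n i).
Definition iy (i : 'I_n) : 'I_(n + n + 1) := lshift 1 (rshift n i).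
Definition iz : 'I_(n + n + 1) := rshift (n + n) ord0.

End Coordinates.

Section AffineConnection.
Context {R : realType} {m : nat}.
Local Notation E := 'rV[R]_m.

(* A connection on R^m is represented by its Christoffel map
   G p v w = \sum_(i, j, k) v_i w_j Gamma^k_ij(p) d/dx_k. *)
Definition nabla (G : E -> E -> E -> E) (X Y : E -> E) (p : E) : E :=
  'D_(X p) Y p + G p (X p) (Y p).

(* Covariant derivative along the curve a of a vector field V along a. *)
Definition nabla_along (G : E -> E -> E -> E) (a V : R -> E) (t : R) : E :=
  derive1 V t + G (a t) (derive1 a t) (V t).

Definition gram (g : E -> E -> E -> R) (p : E) : 'M[R]_m :=
  \matrix_(i, j) g p (delta_mx 0 i) (delta_mx 0 j).

Definition christoffel (g : E -> E -> E -> R) (k i j : 'I_m) (p : E) : R :=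
  2^-1 * \sum_l invmx (gram g p) k l *
    ('D_(delta_mx 0 i) (fun x : E => gram g x j l) p
     + 'D_(delta_mx 0 j) (fun x : E => gram g x i l) p
     - 'D_(delta_mx 0 l) (fun x : E => gram g x i j) p).

Definition levi_civita (g : E -> E -> E -> R) (p v w : E) : E :=
  \row_k \sum_i \sum_j christoffel g k i j p * v 0 i * w 0 j.

End AffineConnection.

Section SasakianSpaceForm.
Context {R : realType} {n : nat}.
Local Notation E := 'rV[R]_(n + n + 1).

Definition eta (p v : E) : R :=
  2^-1 * (v 0 iz - \sum_(i < n) p 0 (iy i) * v 0 (ix i)).

Definition xi : E := 2 *: delta_mx 0 iz.

Definition metric (p v w : E) : R :=
  eta p v * eta p w
  + 4^-1 * \sum_(i < n) (v 0 (ix i) * w 0 (ix i) + v 0 (iy i) * w 0 (iy i)).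

(* phi d/dx_i = - d/dy_i, phi d/dy_i = d/dx_i + y_i d/dz, phi d/dz = 0 *)
Definition phi (p v : E) : E :=
  \sum_(i < n) (v 0 (ix i) *: (- delta_mx 0 (iy i))
    + v 0 (iy i) *: (delta_mx 0 (ix i) + p 0 (iy i) *: delta_mx 0 iz)).

(* Tanaka-Webster and Levi-Civita differ by a tensor, so the defining formula
   can be imposed on Christoffel maps; see nabla_tanaka_webster. *)
Definition tanaka_webster (p v w : E) : E :=
  levi_civita metric p v w
  + eta p v *: phi p w + eta p w *: phi p v - metric p (phi p v) w *: xi.

Lemma nabla_tanaka_webster (X Y : E -> E) (p : E) :
  nabla tanaka_webster X Y p =
  nabla (levi_civita metric) X Y p
  + eta p (X p) *: phi p (Y p) + eta p (Y p) *: phi p (X p)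
  - metric p (phi p (X p)) (Y p) *: xi.
Proof. by rewrite /nabla /tanaka_webster !addrA. Qed.

Definition smooth_on (I : set R) (a : R -> E) : Prop :=
  forall (k : nat) (t : R), I t -> derivable (derive1n k a) t 1.

Definition unit_speed (I : set R) (a : R -> E) : Prop :=
  forall t, I t -> metric (a t) (derive1 a t) (derive1 a t) = 1.

Definition pseudo_hermitian_magnetic (q : R) (I : set R) (a : R -> E) : Prop :=
  [/\ smooth_on I a, unit_speed I a &
      forall t, I t ->
        nabla_along tanaka_webster a (derive1 a) t =
        (- q + 2 * eta (a t) (derive1 a t)) *: phi (a t) (derive1 a t)].

Definition contact_angle (I : set R) (a : R -> E) (theta : R) : Prop :=
  0 <= theta <= pi /\
  forall t, I t -> cos theta = eta (a t) (derive1 a t).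

End SasakianSpaceForm.

(* Main.v *)
Require Import Defs.
From HB Require Import structures.
From mathcomp Require Import all_boot all_order all_algebra.
From mathcomp Require Import all_classical all_reals all_analysis.
From mathcomp Require Import ring lra.
Import Order.TTheory GRing.Theory Num.Theory.
Import numFieldNormedType.Exports.

Set Implicit Arguments.
Unset Strict Implicit.
Unset Printing Implicit Defensive.

Local Open Scope classical_set_scope.
Local Open Scope ring_scope.

(** The parallel frame of the Tanaka-Webster connection reduces everything to
    a linear system.  In coordinates the connection has the single Christoffel
    term - v_y . w_x along d/dz ([tanaka_websterE]).  Hence, with
    l = q - 2 cos theta, a smooth curve is magnetic of contact angle theta
    exactly when
      x_i'' = - l y_i',   y_i'' = l x_i',   z' = 2 cos theta + sum y_i x_i',
      sum (x_i'^2 + y_i'^2) = 4 sin^2 theta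
    ([magnetic_systemP]).  The equation for z' is the contact angle condition,
    and its derivative is the d/dz component of the magnetic equation; the
    last equation is the unit speed.

    Each velocity (x_i', y_i') rotates at constant rate l, so in polar
    coordinates it is c_i (cos (l t + d_i), sin (l t + d_i))
    ([rotation_solution]).  Since two antiderivatives on an interval differ by
    a constant, integrating gives circles when l != 0 ([system_helix]) and
    straight lines when l = 0 ([system_parabola]) in the (x, y) coordinates; the
    height z is then an antiderivative of an explicit function.  Conversely,
    the explicit curves satisfy the system ([helix_system], [parabola_system])
    and are smooth because their coordinates belong to a class of functions
    stable under derivation.

    The coordinate form of the connection requires the Levi-Civita connection
    of g.  Its Christoffel symbols involve the inverse Gram matrix, which is
    never computed: g being nondegenerate, it suffices to check the Koszul
    formula on a proposed value ([levi_civita_unique]). *)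

(* The contact form, not the generic identity function of the same name. *)
Local Notation eta := Defs.eta.

(** * Row vectors and Christoffel symbols *)

Lemma is_derive_rVP (R : realType) (V : normedModType R) (m : nat)
    (f : V -> 'rV[R]_m) (df : 'rV[R]_m) (p a : V) :
  is_derive p a f df <-> forall j, is_derive p a (fun x => f x 0 j) (df 0 j).
Proof.
split=> [[fp <-] j | fp].
  rewrite derive_mx // mxE; apply: DeriveDef => //.
  by have /derivable_mxP/(_ 0 j) := fp.
have fpa : derivable f p a.
  by apply/derivable_mxP => i j; rewrite ord1; case: (fp j).
apply: DeriveDef => //; rewrite derive_mx //; apply/rowP => j.
by rewrite mxE; case: (fp j) => _ ->.
Qed.

Lemma linear_form_rowE (R : realType) (m : nat) (f : 'rV[R]_m -> R)
    (fl : forall k u v, f (k *: u + v) = k * f u + f v) (v : 'rV[R]_m) :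
  f v = \sum_j v 0 j * f (delta_mx 0 j).
Proof.
have f0 : f 0 = 0.
  by have := fl (-1) 0 0; rewrite scaler0 addr0 mulN1r addNr.
rewrite {1}(row_sum_delta v); elim/big_ind2: _ => // [x1 x2 y1 y2 <- <-|j _].
  by have := fl 1 x2 y2; rewrite scale1r mul1r.
by have := fl (v 0 j) (delta_mx 0 j) 0; rewrite f0 !addr0.
Qed.

(** Twice the Christoffel symbol of the first kind. *)
Definition koszul (R : realType) (m : nat)
    (g : 'rV[R]_m -> 'rV[R]_m -> 'rV[R]_m -> R) (i j l : 'I_m) p : R :=
  'D_(delta_mx 0 i) (fun x => gram g x j l) p
  + 'D_(delta_mx 0 j) (fun x => gram g x i l) p
  - 'D_(delta_mx 0 l) (fun x => gram g x i j) p.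

(** The Koszul formula determines the Levi-Civita connection: contracting with
    the inverse Gram matrix solves a linear system that has only one solution,
    so a candidate u can be verified without inverting anything. *)
Lemma levi_civita_unique (R : realType) (m : nat)
    (g : 'rV[R]_m -> 'rV[R]_m -> 'rV[R]_m -> R) (p v w u : 'rV[R]_m) :
  gram g p \in unitmx ->
  (forall l, (gram g p *m u^T) l 0
             = \sum_i \sum_j 2^-1 * koszul g i j l p * v 0 i * w 0 j) ->
  levi_civita g p v w = u.
Proof.
move=> gU gu; apply: trmx_inj; rewrite -[u^T](mulKmx gU).
apply/colP => k; rewrite !mxE /christoffel.
under [RHS]eq_bigr do rewrite gu mulr_sumr.
rewrite [RHS]exchange_big; apply: eq_bigr => i _ /=.
under [RHS]eq_bigr do rewrite mulr_sumr.
rewrite [RHS]exchange_big; apply: eq_bigr => j _ /=.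
rewrite mulr_sumr !mulr_suml; apply: eq_bigr => l _.
by rewrite /koszul !mulrA [_ * 2^-1]mulrC.
Qed.

(** * The Tanaka-Webster connection in coordinates *)

Section Heisenberg.
Context {R : realType} {n : nat}.
Local Notation E := 'rV[R]_(n + n + 1).
Implicit Types p v w e a b c : E.

Lemma coord_ind (P : 'I_(n + n + 1) -> Prop) :
  (forall i, P (ix i)) -> (forall i, P (iy i)) -> P iz -> forall j, P j.
Proof.
move=> Px Py Pz j; rewrite -(fintype.splitK j); case: (fintype.split j) => k /=.
  by rewrite -(fintype.splitK k); case: (fintype.split k) => i;
    [apply: Px|apply: Py].
by rewrite ord1.
Qed.

Lemma ix_inj : injective (@ix n).
Proof. by move=> i j /lshift_inj/lshift_inj. Qed.
Lemma iy_inj : injective (@iy n).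
Proof. by move=> i j /lshift_inj/rshift_inj. Qed.

Definition coordE :=
  (inj_eq ix_inj, inj_eq iy_inj, eq_lshift, eq_rshift, eq_lrshift, eq_rlshift).

Lemma phi_ix p v i : phi p v 0 (ix i) = v 0 (iy i).
Proof.
rewrite summxE (bigD1 i) //= big1 ?addr0 => [|k /negPf ki];
  by rewrite !mxE !coordE ?eqxx ?[i == k]eq_sym ?ki /=; ring.
Qed.

Lemma phi_iy p v i : phi p v 0 (iy i) = - v 0 (ix i).
Proof.
rewrite summxE (bigD1 i) //= big1 ?addr0 => [|k /negPf ki];
  by rewrite !mxE !coordE ?eqxx ?[i == k]eq_sym ?ki /=; ring.
Qed.

Lemma phi_iz p v : phi p v 0 iz = \sum_i p 0 (iy i) * v 0 (iy i).
Proof.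
rewrite summxE; apply: eq_bigr => k _.
by rewrite !mxE !coordE ?eqxx /=; ring.
Qed.

(** The bilinear form sum_i dy_i (x) dx_i.  It governs how the contact form
    varies from point to point, and its antisymmetrization is the fundamental
    2-form. *)
Definition dydx v w : R := \sum_i v 0 (iy i) * w 0 (ix i).

Lemma dydx_linearl w k a b : dydx (k *: a + b) w = k * dydx a w + dydx b w.
Proof.
rewrite mulr_sumr -big_split; apply: eq_bigr => i _; rewrite !mxE /=; ring.
Qed.

Lemma dydx_linearr v k a b : dydx v (k *: a + b) = k * dydx v a + dydx v b.
Proof.
rewrite mulr_sumr -big_split; apply: eq_bigr => i _; rewrite !mxE /=; ring.
Qed.

Lemma etaE p v : eta p v = 2^-1 * (v 0 iz - dydx p v).
Proof. by []. Qed.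

Lemma eta_linear p k a b : eta p (k *: a + b) = k * eta p a + eta p b.
Proof. by rewrite !etaE dydx_linearr !mxE; ring. Qed.

Lemma metricC p v w : metric p v w = metric p w v.
Proof.
rewrite /metric mulrC; congr (_ + _ * _); apply: eq_bigr => i _; ring.
Qed.

Lemma metric_linearr p v k a b :
  metric p v (k *: a + b) = k * metric p v a + metric p v b.
Proof.
rewrite /metric eta_linear.
rewrite (_ : \sum_i _ =
  k * (\sum_(i < n) (v 0 (ix i) * a 0 (ix i) + v 0 (iy i) * a 0 (iy i)))
  + \sum_(i < n) (v 0 (ix i) * b 0 (ix i) + v 0 (iy i) * b 0 (iy i)));
  first ring.
rewrite mulr_sumr -big_split; apply: eq_bigr => i _; rewrite !mxE /=; ring.
Qed.

Lemma metricDr p v a b : metric p v (a + b) = metric p v a + metric p v b.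
Proof. by have := metric_linearr p v 1 a b; rewrite scale1r mul1r. Qed.

Lemma metricZr p v k a : metric p v (k *: a) = k * metric p v a.
Proof.
have m0 : metric p v 0 = 0.
  by have := metric_linearr p v (-1) 0 0; rewrite scaler0 addr0 mulN1r addNr.
by have := metric_linearr p v k a 0; rewrite m0 !addr0.
Qed.

Lemma metric_eq0 p v : metric p v v = 0 -> v = 0.
Proof.
have sq_ge0 i : 0 <= v 0 (ix i) * v 0 (ix i) + v 0 (iy i) * v 0 (iy i).
  by rewrite -!expr2 addr_ge0 ?sqr_ge0.
rewrite /metric -expr2 => /eqP; rewrite paddr_eq0 ?sqr_ge0 //; last first.
  by rewrite mulr_ge0 ?invr_ge0 ?ler0n ?sumr_ge0.
rewrite sqrf_eq0 !mulf_eq0 !invr_eq0 !pnatr_eq0 => /andP[/eqP z0 /eqP S0].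
have v0 i : v 0 (ix i) = 0 /\ v 0 (iy i) = 0.
  have /(_ i isT)/eqP := psumr_eq0P (fun i _ => sq_ge0 i) S0.
  by rewrite paddr_eq0 -?expr2 ?sqr_ge0 // !sqrf_eq0 => /andP[/eqP ? /eqP].
apply/rowP => j; rewrite mxE; elim/coord_ind: j => [i|i|]; try by case: (v0 i).
by rewrite -z0 big1 ?subr0 // => i _; rewrite (v0 i).1 mulr0.
Qed.

Lemma gram_metric_mulmx p u l :
  (gram metric p *m u^T) l 0 = metric p (delta_mx 0 l) u.
Proof.
rewrite [RHS](linear_form_rowE (metric_linearr p (delta_mx 0 l))) mxE.
by apply: eq_bigr => k _; rewrite !mxE mulrC.
Qed.

(** A Gram matrix of a positive definite form has trivial kernel. *)
Lemma gram_metric_unit p : gram metric p \in unitmx.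
Proof.
rewrite -unitmx_tr -row_free_unit; apply: inj_row_free => v vG0.
apply: (metric_eq0 (p := p)); rewrite (linear_form_rowE (metric_linearr p v)).
rewrite big1 // => l _; rewrite metricC -gram_metric_mulmx.
by rewrite -[gram metric p]trmxK -trmx_mul vG0 !mxE mulr0.
Qed.

Lemma is_derive_coord p a j : is_derive p a (fun x : E => x 0 j) (a 0 j).
Proof. by have /is_derive_rVP/(_ j) := is_derive_id p a. Qed.

(** The base point enters the contact form only through the coefficients y_i
    of dx_i. *)
Lemma is_derive_eta p a b : is_derive p a (eta^~ b) (- 2^-1 * dydx a b).
Proof.
have dc := is_derive_coord p a.
rewrite (_ : eta^~ b = 2^-1 \*: (cst (b 0 iz)
  - \sum_(i < n) (b 0 (ix i)) \*: (fun x : E => x 0 (iy i)))).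
  apply: is_derive_eq; rewrite sub0r scalerN mulNr; congr (- (_ * _)).
  by apply: eq_bigr => i _; rewrite mulrC.
apply/funext => x; rewrite etaE /=; congr (_ * (_ - _)).
by rewrite fct_sumE; apply: eq_bigr => i _; rewrite mulrC.
Qed.

Lemma derive_metric p a b c :
  'D_a (fun x => metric x b c) p
  = - 2^-1 * (dydx a b * eta p c + eta p b * dydx a c).
Proof.
have db := is_derive_eta p a b; have dc := is_derive_eta p a c.
have -> : (fun x => metric x b c) = eta^~ b * eta^~ c
   + cst (metric p b c - eta p b * eta p c).
  by apply/funext => x; rewrite !fctE /metric; ring.
by rewrite derive_val /GRing.scale /=; ring.
Qed.

Lemma metric_phi p w e : metric p e (phi p w) = 4^-1 * (dydx w e - dydx e w).
Proof.
rewrite /metric [eta p (phi p w)]etaE phi_iz /dydx.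
under [X in _ * (2^-1 * (_ - X))]eq_bigr do rewrite phi_ix.
rewrite subrr !mulr0 add0r; congr (_ * _); rewrite -sumrB.
by apply: eq_bigr => i _; rewrite phi_ix phi_iy; ring.
Qed.

Lemma metric_dz p e : metric p e (delta_mx 0 iz) = 2^-1 * eta p e.
Proof.
rewrite /metric [X in _ * X]etaE /dydx !big1 => [|i _|i _];
  by rewrite !mxE !coordE ?eqxx /=; ring.
Qed.

(** The value is the one for which adding the three tensors of the
    Tanaka-Webster formula leaves only - dydx v w d/dz, the connection making
    d/dy_i, d/dx_i + y_i d/dz and d/dz parallel.  Both sides of the Koszul
    formula are multilinear in (v, w, e), and they agree as polynomials in the
    values of [dydx] and [eta]. *)
Lemma levi_civita_metricE p v w :
  levi_civita metric p v w =
  - dydx v w *: delta_mx 0 iz - eta p v *: phi p w - eta p w *: phi p v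
  + metric p (phi p v) w *: xi.
Proof.
apply: levi_civita_unique (gram_metric_unit p) _ => l.
pose e : E := delta_mx 0 l.
(* The right-hand side of the Koszul formula for arbitrary vectors a, b
   instead of coordinate ones. *)
pose K a b : R := 2^-1 * (- 2^-1 * (dydx a b * eta p e + eta p b * dydx a e)
  - 2^-1 * (dydx b a * eta p e + eta p a * dydx b e)
  + 2^-1 * (dydx e a * eta p b + eta p a * dydx e b)).
have KE i j : 2^-1 * koszul metric i j l p = K (delta_mx 0 i) (delta_mx 0 j).
  rewrite /koszul /K /e.
  under eq_fun do rewrite mxE.
  under [X in _ + 'D_(_) X _]eq_fun do rewrite mxE.
  under [X in _ - 'D_(_) X _]eq_fun do rewrite mxE.
  by rewrite !derive_metric; ring.
have Kl b k a a' : K (k *: a + a') b = k * K a b + K a' b.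
  by rewrite /K !(dydx_linearl, dydx_linearr, eta_linear); ring.
have Kr a k b b' : K a (k *: b + b') = k * K a b + K a b'.
  by rewrite /K !(dydx_linearl, dydx_linearr, eta_linear); ring.
transitivity (K v w); last first.
  rewrite (linear_form_rowE (Kl w)); apply: eq_bigr => i _.
  rewrite (linear_form_rowE (Kr _)) mulr_sumr; apply: eq_bigr => j _.
  by rewrite KE; ring.
rewrite gram_metric_mulmx -/e -[- (eta p v *: _)]scaleNr.
rewrite -[- (eta p w *: _)]scaleNr /xi !(metricDr, metricZr) metric_dz.
by rewrite (metricC p (phi p v)) !metric_phi /K; field.
Qed.

(** On d/dx_i + y_i d/dz, d/dy_i and d/dz, the frame made parallel, a constant
    field w has the coefficients w_x, w_y and w_z - y . w_x, of which only the
    last one varies: its derivative along v is - v_y . w_x. *)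
Lemma tanaka_websterE p v w :
  tanaka_webster p v w = - dydx v w *: delta_mx 0 iz.
Proof.
rewrite /tanaka_webster levi_civita_metricE.
by rewrite [_ + eta p v *: _]addrAC [_ + eta p w *: _]addrAC addrK
  [_ + eta p v *: _]addrAC !subrK.
Qed.

End Heisenberg.

(** * Antiderivatives and plane rotations on an interval *)

Section Calculus.
Context {R : realType}.
Implicit Types (f g u w : R -> R) (I : set R).

Lemma is_derive_unique f (t a b : R) :
  is_derive t 1 f a -> is_derive t 1 f b -> a = b.
Proof. by move=> [_ <-] [_ <-]. Qed.

Lemma is_derive_fD f g (t a b : R) : is_derive t 1 f a -> is_derive t 1 g b ->
  is_derive t 1 (fun s : R => f s + g s) (a + b).
Proof. exact: is_deriveD. Qed.

Lemma is_derive_fM f g (t a b : R) : is_derive t 1 f a -> is_derive t 1 g b ->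
  is_derive t 1 (fun s : R => f s * g s) (f t * b + g t * a).
Proof. exact: is_deriveM. Qed.

Lemma is_derive_fZ k f (t a : R) : is_derive t 1 f a ->
  is_derive t 1 (fun s : R => k * f s) (k * a).
Proof. exact: is_deriveZ. Qed.

Lemma is_derive_cstD k f (t a : R) : is_derive t 1 f a ->
  is_derive t 1 (fun s : R => k + f s) a.
Proof. by move=> fa; rewrite -[a]add0r; apply: is_deriveD. Qed.

Lemma is_derive_Dcst k f (t a : R) : is_derive t 1 f a ->
  is_derive t 1 (fun s : R => f s + k) a.
Proof. by move=> fa; rewrite -[a]addr0; apply: is_deriveD. Qed.

Lemma is_derive_fsum n (f : 'I_n -> R -> R) (df : 'I_n -> R) (t : R) :
  (forall i, is_derive t 1 (f i) (df i)) ->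
  is_derive t 1 (fun s : R => \sum_i f i s) (\sum_i df i).
Proof. by move=> dfi; rewrite -fct_sumE; apply: is_derive_sum. Qed.

Lemma is_derive_affine (l d t : R) : is_derive t 1 (fun s : R => l * s + d) l.
Proof.
apply: is_derive_Dcst.
by have := is_derive_fZ l (is_derive_id t (1 : R)); rewrite mulr1.
Qed.

Lemma is_derive_sin_affine (l d t : R) :
  is_derive t 1 (fun s : R => sin (l * s + d)) (l * cos (l * t + d)).
Proof.
rewrite mulrC; have := @is_derive1_comp _ sin (fun s => l * s + d) t _ _
  (is_derive_sin (l * t + d)) (is_derive_affine l d t).
by rewrite /GRing.scale /= mulrC.
Qed.

Lemma is_derive_cos_affine (l d t : R) :
  is_derive t 1 (fun s : R => cos (l * s + d)) (- l * sin (l * t + d)).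
Proof.
have := @is_derive1_comp _ cos (fun s => l * s + d) t _ _
  (is_derive_cos (l * t + d)) (is_derive_affine l d t).
by rewrite /GRing.scale /= mulNr mulNr mulrC.
Qed.

(** The difference has derivative zero: apply the mean value theorem on the
    segment from a base point to t. *)
Lemma antiderivative_unique I f g df : is_interval I -> I !=set0 ->
  (forall t, I t -> is_derive t 1 f (df t)) ->
  (forall t, I t -> is_derive t 1 g (df t)) ->
  exists k, forall t, I t -> f t = g t + k.
Proof.
move=> Iitv [t0 It0] df_ dg_; exists (f t0 - g t0) => t It.
pose h := f - g.
have dh s : I s -> is_derive s 1 h 0.
  move=> Is; rewrite -(subrr (df s)).
  by apply: is_deriveB; [exact: df_|exact: dg_].
have hle a b : I a -> I b -> a <= b -> h b = h a.
  move=> Ia Ib ab.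
  have Iab s : s \in `[a, b]%R -> I s.
    by rewrite in_itv => /andP[? ?]; apply: (Iitv a b) => //; apply/andP.
  have hab s : s \in `]a, b[%R -> is_derive s 1 h 0.
    by move=> /subset_itv_oo_cc/Iab/dh.
  have [|c _] := MVT_segment ab hab; last first.
    by rewrite mul0r => /eqP; rewrite subr_eq0 => /eqP.
  by apply: derivable_within_continuous => s /Iab/dh[].
have : h t = h t0.
  by case: (leP t0 t) => [|/ltW] le_t; [apply: hle|apply/esym/hle].
rewrite /h !fctE => E; rewrite -E; ring.
Qed.

Lemma polar_coordinates (A B : R) :
  exists c d : R, A = c * cos d /\ B = c * sin d.
Proof.
(* The arc cosine has a nonnegative sine, so the sign of B goes into c. *)
wlog B0 : A B / 0 <= B.
  move=> H; case: (leP 0 B) => [|/ltW B0]; first exact: H.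
  have [|c [d [Ac Bc]]] := H (- A) (- B); first by rewrite oppr_ge0.
  by exists (- c), d; rewrite !mulNr -Ac -Bc !opprK.
pose c := Num.sqrt (A ^+ 2 + B ^+ 2).
have c2 : c ^+ 2 = A ^+ 2 + B ^+ 2 by rewrite sqr_sqrtr // addr_ge0 ?sqr_ge0.
have [c0|c0] := eqVneq c 0.
  exists 0, 0; rewrite !mul0r; move: c2; rewrite c0 expr0n /= => /esym/eqP.
  by rewrite paddr_eq0 ?sqr_ge0 // !sqrf_eq0 => /andP[/eqP -> /eqP ->].
have cp : 0 < c by rewrite lt_neqAle eq_sym c0 sqrtr_ge0.
have Ac1 : -1 <= A / c <= 1.
  rewrite -ler_norml normrM normfV (gtr0_norm cp) ler_pdivrMr // mul1r.
  by rewrite -sqrtr_sqr ler_sqrt ?lerDl ?addr_ge0 ?sqr_ge0.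
exists c, (acos (A / c)); rewrite sin_acos // acosK ?in_itv //=; split.
  by rewrite mulrC divfK.
have -> : 1 - (A / c) ^+ 2 = (B / c) ^+ 2.
  by rewrite -(@divff _ (c ^+ 2)) ?expf_neq0 // {1}c2; field.
by rewrite sqrtr_sqr ger0_norm ?divr_ge0 ?(ltW cp) // mulrC divfK.
Qed.

(** In the frame rotating at rate l the vector (u, w) has derivative zero, so
    its coordinates A, B there are constant; then write (A, B) in polar form. *)
Lemma rotation_solution I u w (l : R) : is_interval I -> I !=set0 ->
  (forall t, I t -> is_derive t 1 u (- l * w t)) ->
  (forall t, I t -> is_derive t 1 w (l * u t)) ->
  exists c d : R, forall t, I t ->
    u t = c * cos (l * t + d) /\ w t = c * sin (l * t + d).
Proof.
move=> Iitv I0 du dw.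
(* The zero shift gives sin and cos of l t + d, whose derivatives are known. *)
pose S t := sin (l * t + 0); pose C t := cos (l * t + 0).
have dS (t : R) : is_derive t 1 S (l * C t) by apply: is_derive_sin_affine.
have dC (t : R) : is_derive t 1 C (- l * S t) by apply: is_derive_cos_affine.
have SC t : C t ^+ 2 + S t ^+ 2 = 1 by exact: cos2Dsin2.
have d0 (k t : R) (_ : I t) : is_derive t 1 (cst k) (0 : R).
  exact: is_derive_cst.
have [t It|A uwA] := antiderivative_unique Iitv I0 _ (d0 0)
    (f := fun t => C t * u t + S t * w t).
  apply: is_derive_eq (is_derive_fD (is_derive_fM (dC t) (du t It))
    (is_derive_fM (dS t) (dw t It))) _; ring.
have [t It|B uwB] := antiderivative_unique Iitv I0 _ (d0 0)
    (f := fun t => C t * w t + -1 * S t * u t).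
  apply: is_derive_eq (is_derive_fD (is_derive_fM (dC t) (dw t It))
    (is_derive_fM (is_derive_fZ (-1) (dS t)) (du t It))) _; ring.
have [c [d [Ac Bc]]] := polar_coordinates A B; exists c, d => t It.
have /= := uwA t It; have /= := uwB t It; rewrite !add0r Ac Bc => Bt At.
rewrite sinD cosD -[l * t]addr0 -/(S t) -/(C t); split.
  by rewrite -[LHS]mul1r -(SC t) mulrBr ![c * (_ * _)]mulrCA -At -Bt; ring.
by rewrite -[LHS]mul1r -(SC t) mulrDr ![c * (_ * _)]mulrCA -At -Bt; ring.
Qed.

End Calculus.

(** * Smooth curves *)

Section Smoothness.
Context {R : realType}.

(** An algebra of functions that contains the coordinates of the explicit
    curves and is stable under derivation: smoothness of its members follows by
    induction on the order of derivation, with no Leibniz formula. *)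
Inductive elementary : (R -> R) -> Prop :=
| elementary_cst k : elementary (fun _ => k)
| elementary_id : elementary (fun t => t)
| elementary_sin l d : elementary (fun t => sin (l * t + d))
| elementary_cos l d : elementary (fun t => cos (l * t + d))
| elementaryD f g :
    elementary f -> elementary g -> elementary (fun t => f t + g t)
| elementaryM f g :
    elementary f -> elementary g -> elementary (fun t => f t * g t).

Lemma elementary_sum n (f : 'I_n -> R -> R) :
  (forall i, elementary (f i)) -> elementary (fun t => \sum_i f i t).
Proof.
elim: n f => [|n IHn] f ef.
  under eq_fun do rewrite big_ord0; exact: elementary_cst.
under eq_fun do rewrite big_ord_recl.
by apply: elementaryD => //; apply: IHn => i; apply: ef.
Qed.

Lemma elementary_derive f : elementary f ->
  exists2 df, elementary df & forall t : R, is_derive t 1 f (df t).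
Proof.
elim=> [k||l d|l d|{}f g ef [df edf fdf] eg [dg edg gdg]
        |{}f g ef [df edf fdf] eg [dg edg gdg]].
- by exists (cst 0) => [|t]; [apply: elementary_cst|apply: is_derive_cst].
- by exists (cst 1) => [|t]; [apply: elementary_cst|apply: is_derive_id].
- exists (fun t => l * cos (l * t + d)) => [|t]; last first.
    exact: is_derive_sin_affine.
  exact: elementaryM (elementary_cst _) (elementary_cos _ _).
- exists (fun t => - l * sin (l * t + d)) => [|t]; last first.
    exact: is_derive_cos_affine.
  exact: elementaryM (elementary_cst _) (elementary_sin _ _).
- exists (fun t => df t + dg t) => [|t]; first exact: elementaryD.
  exact: is_derive_fD.
- exists (fun t => f t * dg t + g t * df t) => [|t]; last exact: is_derive_fM.
  by apply: elementaryD; apply: elementaryM.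
Qed.

Context {n : nat} (I : set R) (Iopen : open I) (a : R -> 'rV[R]_(n + n + 1)).

Lemma is_derive_derive1n k t : smooth_on I a -> I t ->
  forall j, is_derive t 1 (fun s => derive1n k a s 0 j) (derive1n k.+1 a t 0 j).
Proof.
move=> sa It; apply/is_derive_rVP; apply: DeriveDef; first exact: sa.
by rewrite derive1nS derive1E.
Qed.

Lemma is_derive_coord_on k j (f : R -> R) t df :
  (forall s, I s -> derive1n k a s 0 j = f s) -> I t ->
  is_derive t 1 f df -> is_derive t 1 (fun s => derive1n k a s 0 j) df.
Proof.
move=> af It; apply: near_eq_is_derive.
by have : \near t, I t by [apply: open_nbhs_nbhs];
  apply: filterS => s /af.
Qed.

Lemma derive1n_coord k j (f df : R -> R) : smooth_on I a ->
  (forall t, I t -> derive1n k a t 0 j = f t) ->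
  (forall t, I t -> is_derive t 1 f (df t)) ->
  forall t, I t -> derive1n k.+1 a t 0 j = df t.
Proof.
move=> sa af fdf t It; apply: is_derive_unique (is_derive_derive1n k sa It j) _.
exact: is_derive_coord_on (fdf t It).
Qed.

(** A curve is prescribed on I only, and I is open, so each derivative is again
    elementary on I. *)
Lemma smooth_on_elementary :
  (forall j, exists2 f, elementary f & forall t, I t -> a t 0 j = f t) ->
  smooth_on I a.
Proof.
move=> a_el.
pose el k := forall j,
  exists2 f, elementary f & forall t, I t -> derive1n k a t 0 j = f t.
have el_derivable k t : el k -> I t -> derivable (derive1n k a) t 1.
  move=> elk It; apply/derivable_mxP => i j; rewrite ord1.
  have [f /elementary_derive[df _ fdf] af] := elk j.
  by have [] := is_derive_coord_on af It (fdf t).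
move=> k t It; apply: (el_derivable) => //.
elim: k => [//|k IHk] j.
have [f /elementary_derive[df edf fdf] af] := IHk j.
exists df => // s Is.
apply: is_derive_unique (is_derive_coord_on af Is (fdf s)).
have ds : is_derive s 1 (derive1n k a) (derive1n k.+1 a s).
  by apply: DeriveDef; [exact: el_derivable|rewrite derive1nS derive1E].
exact: (is_derive_rVP _ _ _ _).1 ds j.
Qed.

End Smoothness.

(* Constants come first: a constant product would otherwise be split. *)
Ltac elem := repeat first [apply: elementary_cst | apply: elementary_id
  | apply: elementary_sin | apply: elementary_cos | apply: elementaryD
  | apply: elementaryM | apply: elementary_sum => ?].

(** * Magnetic curves as solutions of a linear system *)

Section Magnetic.
Context {R : realType} {n : nat}.
Local Notation E := 'rV[R]_(n + n + 1).
Context (I : set R) (a : R -> 'rV[R]_(n + n + 1)).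

(** The derivatives of orders 1 and 2 are written as iterated derivatives, the
    form in which smoothness provides them. *)
Definition magnetic_system (l theta : R) : Prop := forall t, I t ->
  [/\ forall i, derive1n 2 a t 0 (ix i) = - l * derive1n 1 a t 0 (iy i),
      forall i, derive1n 2 a t 0 (iy i) = l * derive1n 1 a t 0 (ix i),
      derive1n 1 a t 0 iz
      = 2 * cos theta + \sum_(i < n) a t 0 (iy i) * derive1n 1 a t 0 (ix i) &
      \sum_(i < n) (derive1n 1 a t 0 (ix i) ^+ 2 + derive1n 1 a t 0 (iy i) ^+ 2)
      = 4 * sin theta ^+ 2].

Lemma unit_speedE (p v : E) theta : eta p v = cos theta ->
  metric p v v = 1 <->
  \sum_(i < n) (v 0 (ix i) ^+ 2 + v 0 (iy i) ^+ 2) = 4 * sin theta ^+ 2.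
Proof.
rewrite /metric => ->; under eq_bigr do rewrite -!expr2.
by have := cos2Dsin2 theta; rewrite -expr2; split; lra.
Qed.

Lemma magnetic_equationE t (l : R) :
  nabla_along tanaka_webster a (derive1 a) t = - l *: phi (a t) (derive1 a t)
  <-> [/\ forall i, derive1n 2 a t 0 (ix i) = - l * derive1n 1 a t 0 (iy i),
          forall i, derive1n 2 a t 0 (iy i) = l * derive1n 1 a t 0 (ix i) &
          derive1n 2 a t 0 iz = \sum_(i < n)
            (derive1n 1 a t 0 (iy i) * derive1n 1 a t 0 (ix i)
             - l * (a t 0 (iy i) * derive1n 1 a t 0 (iy i)))].
Proof.
rewrite /nabla_along tanaka_websterE.
have X i (u : E) (k : R) :
    (u + k *: delta_mx 0 iz) 0 (ix i) = u 0 (ix i).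
  by rewrite !mxE !coordE /= mulr0 addr0.
have Y i (u : E) (k : R) :
    (u + k *: delta_mx 0 iz) 0 (iy i) = u 0 (iy i).
  by rewrite !mxE !coordE /= mulr0 addr0.
have Z (u : E) (k : R) : (u + k *: delta_mx 0 iz) 0 iz = u 0 iz + k.
  by rewrite !mxE !coordE /= mulr1.
have S k (u : E) j : (k *: u) 0 j = k * u 0 j by rewrite mxE.
split=> [/rowP E|[Ex Ey Ez]].
  split=> [i|i|].
  - by have := E (ix i); rewrite X S phi_ix.
  - by have := E (iy i); rewrite Y S phi_iy mulrNN.
  have := E iz; rewrite Z S phi_iz sumrB -mulr_sumr => /eqP.
  by rewrite subr_eq => /eqP ->; rewrite mulNr addrC.
apply/rowP; apply: coord_ind => [i|i|].
- by rewrite X S phi_ix.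
- by rewrite Y S phi_iy mulrNN.
by rewrite Z S phi_iz Ez sumrB -mulr_sumr addrAC subrr add0r mulNr.
Qed.

(** Only the d/dz component needs an argument: it is absent from the system
    because it is the derivative of the equation for z'. *)
Lemma magnetic_systemP (q theta : R) : open I -> 0 <= theta <= pi ->
  smooth_on I a ->
  pseudo_hermitian_magnetic q I a /\ contact_angle I a theta
  <-> magnetic_system (q - 2 * cos theta) theta.
Proof.
move=> Iopen th sa.
have muE : - q + 2 * cos theta = - (q - 2 * cos theta) by rewrite opprB addrC.
split=> [[[_ us mag] [_ ca]] t It | sys].
  have := mag t It; rewrite -ca // muE => /magnetic_equationE[Ex Ey _].
  split=> //; last by apply/(unit_speedE (esym (ca t It))); exact: us.
  have := ca t It; rewrite etaE => ->.
  by rewrite mulrA divff ?pnatr_eq0 // mul1r subrK.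
have etaE t : I t -> cos theta = eta (a t) (derive1 a t).
  move=> /sys[_ _ Ez _]; rewrite etaE -[derive1 a t 0 iz]/(derive1n 1 a t 0 iz).
  by rewrite Ez addrK mulrA mulVf ?pnatr_eq0 // mul1r.
split=> //; split=> // t It.
  by apply/(unit_speedE (esym (etaE t It))); case: (sys t It).
rewrite -etaE // muE; apply/magnetic_equationE; case: (sys t It) => Ex Ey _ _.
split=> //.
(* Differentiate the equation for z', then replace x_i'' by - l y_i'. *)
transitivity (\sum_(i < n) (a t 0 (iy i) * derive1n 2 a t 0 (ix i)
    + derive1n 1 a t 0 (ix i) * derive1n 1 a t 0 (iy i))); last first.
  by apply: eq_bigr => i _; rewrite Ex; ring.
have Ez s : I s -> derive1n 1 a s 0 iz
    = 2 * cos theta + \sum_(i < n) a s 0 (iy i) * derive1n 1 a s 0 (ix i).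
  by case/sys.
apply: is_derive_unique (is_derive_derive1n 1 sa It iz) _.
apply: (is_derive_coord_on Iopen Ez It).
apply: is_derive_cstD; apply: is_derive_fsum => i.
exact: is_derive_fM (is_derive_derive1n 0 sa It _)
  (is_derive_derive1n 1 sa It _).
Qed.

End Magnetic.

(** * Integration of the system *)

Section Solutions.
Context {R : realType}.
Implicit Types (l d c h t theta : R).

Lemma is_derive_helix_x l c d t : l != 0 ->
  is_derive t 1 (fun s : R => c / l * sin (l * s + d)) (c * cos (l * t + d)).
Proof.
move=> l0; apply: is_derive_eq (is_derive_fZ _ (is_derive_sin_affine l d t)) _.
by rewrite mulrA divfK.
Qed.

Lemma is_derive_helix_y l c d t : l != 0 ->
  is_derive t 1 (fun s : R => - c / l * cos (l * s + d)) (c * sin (l * t + d)).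
Proof.
move=> l0; apply: is_derive_eq (is_derive_fZ _ (is_derive_cos_affine l d t)) _.
by rewrite mulrA mulrN divfK // opprK.
Qed.

(** The antiderivative of y x' along one circle; the double angle comes from
    2 cos^2 u = 1 + cos (2 u). *)
Lemma is_derive_helix_z l c d h t : l != 0 ->
  is_derive t 1
    (fun s : R => - c ^+ 2 / (4 * l ^+ 2)
                 * (2 * (l * s + d) + sin (2 * (l * s + d)))
               + c * h / l * sin (l * s + d))
    ((- c / l * cos (l * t + d) + h) * (c * cos (l * t + d))).
Proof.
move=> l0; under eq_fun do rewrite [2 * (_ + _)]mulrDr mulrA.
apply: is_derive_eq (is_derive_fD (is_derive_fZ _ (is_derive_fD
  (is_derive_affine (2 * l) (2 * d) t)
  (is_derive_sin_affine (2 * l) (2 * d) t)))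
  (is_derive_fZ _ (is_derive_sin_affine l d t))) _.
have -> : 2 * l * t + 2 * d = (l * t + d) + (l * t + d) by ring.
rewrite cosD -[sin _ * sin _]expr2 sin2cos2; field.
by rewrite l0.
Qed.

Lemma is_derive_height n theta (f : 'I_n -> R -> R) (df : 'I_n -> R) t :
  (forall i, is_derive t 1 (f i) (df i)) ->
  is_derive t 1 (fun s : R => 2 * s * cos theta + \sum_i f i s)
    (2 * cos theta + \sum_i df i).
Proof.
move=> fdf; apply: is_derive_fD; last exact: is_derive_fsum.
under eq_fun do rewrite mulrAC.
have := is_derive_fZ (2 * cos theta) (is_derive_id t (1 : R)).
by rewrite mulr1.
Qed.

Lemma is_derive_parabola (a b : R) t :
  is_derive t 1 (fun s : R => a / 2 * s ^+ 2 + b * s) (a * t + b).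
Proof.
have di := is_derive_id t (1 : R).
under eq_fun do rewrite expr2.
apply: is_derive_eq
  (is_derive_fD (is_derive_fZ _ (is_derive_fM di di)) (is_derive_fZ b di)) _.
by rewrite /=; field.
Qed.

End Solutions.

Section Classification.
Context {R : realType} {n : nat}.
Context (I : set R) (a : R -> 'rV[R]_(n + n + 1)).
Context (Iopen : open I) (Iitv : is_interval I) (I0 : I !=set0).

Lemma ext_coord (hx hy : 'I_n -> R) (hz : R) : exists h : 'I_(n + n + 1) -> R,
  [/\ forall i, h (ix i) = hx i, forall i, h (iy i) = hy i & h iz = hz].
Proof.
exists (row_mx (row_mx (\row_i hx i) (\row_i hy i)) (const_mx hz) 0).
by split=> *; rewrite ?row_mxEl ?row_mxEr ?row_mxEl ?row_mxEr mxE.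
Qed.

Definition helix (l theta : R) (c d : 'I_n -> R) (h : 'I_(n + n + 1) -> R) :=
  forall t, I t ->
  [/\ forall i, a t 0 (ix i) = c i / l * sin (l * t + d i) + h (ix i),
      forall i, a t 0 (iy i) = - c i / l * cos (l * t + d i) + h (iy i) &
      a t 0 iz = 2 * t * cos theta
          + \sum_(i < n)
              (- c i ^+ 2 / (4 * l ^+ 2)
                 * (2 * (l * t + d i) + sin (2 * (l * t + d i)))
               + c i * h (iy i) / l * sin (l * t + d i))
          + h iz].

Lemma system_helix l theta : l != 0 -> smooth_on I a ->
  magnetic_system I a l theta ->
  exists (c d : 'I_n -> R) (h : 'I_(n + n + 1) -> R),
    \sum_(i < n) c i ^+ 2 = 4 * sin theta ^+ 2 /\ helix l theta c d h.
Proof.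
move=> l0 sa sys.
have da k t (It : I t) := is_derive_derive1n k sa It.
have /choice[c /choice[d vel]] i : exists c d, forall t, I t ->
    derive1n 1 a t 0 (ix i) = c * cos (l * t + d) /\
    derive1n 1 a t 0 (iy i) = c * sin (l * t + d).
  apply: rotation_solution => // t It; have [Ex Ey _ _] := sys t It.
    by rewrite -Ex; exact: da.
  by rewrite -Ey; exact: da.
have /choice[hx Hx] i : exists h, forall t, I t ->
    a t 0 (ix i) = c i / l * sin (l * t + d i) + h.
  apply: antiderivative_unique Iitv I0 (fun t It => da 0 t It (ix i)) _ => t It.
  by rewrite (vel i t It).1; exact: is_derive_helix_x.
have /choice[hy Hy] i : exists h, forall t, I t ->
    a t 0 (iy i) = - c i / l * cos (l * t + d i) + h.
  apply: antiderivative_unique Iitv I0 (fun t It => da 0 t It (iy i)) _ => t It.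
  by rewrite (vel i t It).2; exact: is_derive_helix_y.
have [t It|hz Hz] := antiderivative_unique Iitv I0
    (fun t It => da 0 t It iz) _
    (g := fun t => 2 * t * cos theta + \sum_(i < n) (
      - c i ^+ 2 / (4 * l ^+ 2)
                 * (2 * (l * t + d i) + sin (2 * (l * t + d i)))
               + c i * hy i / l * sin (l * t + d i))).
  have [_ _ -> _] := sys t It; apply: is_derive_height => i.
  by rewrite Hy // (vel i t It).1; exact: is_derive_helix_z.
have [h [hxE hyE hzE]] := ext_coord hx hy hz.
exists c, d, h; split.
  have [t0 It0] := I0; have [_ _ _ <-] := sys t0 It0; apply: eq_bigr => i _.
  have [-> ->] := vel i t0 It0.
  by rewrite !exprMn -mulrDr cos2Dsin2 mulr1.
move=> t It; split=> [i|i|].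
- by rewrite hxE Hx.
- by rewrite hyE Hy.
by rewrite hzE; under eq_bigr do rewrite hyE; exact: Hz.
Qed.

Lemma helix_system l theta c d h : l != 0 ->
  \sum_(i < n) c i ^+ 2 = 4 * sin theta ^+ 2 -> helix l theta c d h ->
  smooth_on I a /\ magnetic_system I a l theta.
Proof.
move=> l0 c2 hel.
have ex i t : I t ->
    derive1n 0 a t 0 (ix i) = c i / l * sin (l * t + d i) + h (ix i).
  by case/hel.
have ey i t : I t ->
    derive1n 0 a t 0 (iy i) = - c i / l * cos (l * t + d i) + h (iy i).
  by case/hel.
have ez t : I t -> derive1n 0 a t 0 iz = 2 * t * cos theta
    + \sum_(i < n) (- c i ^+ 2 / (4 * l ^+ 2)
        * (2 * (l * t + d i) + sin (2 * (l * t + d i)))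
      + c i * h (iy i) / l * sin (l * t + d i)) + h iz.
  by case/hel.
have sa : smooth_on I a.
  apply: smooth_on_elementary => //; apply: coord_ind => [i|i|].
  - by exists (fun t => c i / l * sin (l * t + d i) + h (ix i));
      [elem|apply: ex].
  - by exists (fun t => - c i / l * cos (l * t + d i) + h (iy i));
      [elem|apply: ey].
  (* Expanding 2 (l t + d) exhibits the double angle as an affine argument. *)
  eexists; last exact: ez; under eq_fun do
    under eq_bigr do rewrite [X in sin X]mulrDr [X in sin (X + _)]mulrA.
  by elem.
split=> //.
have vx i : forall t, I t -> derive1n 1 a t 0 (ix i) = c i * cos (l * t + d i).
  apply: derive1n_coord (ex i) _ => // t It.
  by apply: is_derive_Dcst; exact: is_derive_helix_x.
have vy i : forall t, I t -> derive1n 1 a t 0 (iy i) = c i * sin (l * t + d i).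
  apply: derive1n_coord (ey i) _ => // t It.
  by apply: is_derive_Dcst; exact: is_derive_helix_y.
have vz : forall t, I t -> derive1n 1 a t 0 iz = 2 * cos theta
    + \sum_(i < n) (- c i / l * cos (l * t + d i) + h (iy i))
        * (c i * cos (l * t + d i)).
  apply: derive1n_coord ez _ => // t It; apply: is_derive_Dcst.
  by apply: is_derive_height => i; exact: is_derive_helix_z.
move=> t It; split=> [i|i||].
- rewrite (derive1n_coord Iopen sa (vx i)
    (fun s _ => is_derive_fZ _ (is_derive_cos_affine _ _ s)) It) vy //; ring.
- rewrite (derive1n_coord Iopen sa (vy i)
    (fun s _ => is_derive_fZ _ (is_derive_sin_affine _ _ s)) It) vx //; ring.
- by rewrite vz //; congr (_ + _); apply: eq_bigr => i _; rewrite vx // -ey.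
rewrite -c2; apply: eq_bigr => i _; rewrite vx // vy //.
by rewrite !exprMn -mulrDr cos2Dsin2 mulr1.
Qed.

Definition parabola (theta : R) (c : 'I_(n + n + 1) -> R)
    (d : 'I_(n + n) -> R) :=
  forall t, I t ->
  (forall i : 'I_(n + n), a t 0 (lshift 1 i) = c (lshift 1 i) * t + d i) /\
  a t 0 iz = 2 * t * cos theta
          + \sum_(i < n)
              c (ix i) * (c (iy i) / 2 * t ^+ 2 + d (rshift n i) * t)
          + c iz.

Lemma system_parabola theta : smooth_on I a -> magnetic_system I a 0 theta ->
  exists (c : 'I_(n + n + 1) -> R) (d : 'I_(n + n) -> R),
    \sum_(i < n + n) c (lshift 1 i) ^+ 2 = 4 * sin theta ^+ 2 /\
    parabola theta c d.
Proof.
move=> sa sys.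
have da k t (It : I t) := is_derive_derive1n k sa It.
have acc t : I t -> forall i, derive1n 2 a t 0 (lshift 1 i) = 0.
  move=> /sys[Ex Ey _ _] i; rewrite -(fintype.splitK i).
  case: (fintype.split i) => k /=; first by rewrite [LHS]Ex oppr0 mul0r.
  by rewrite [LHS]Ey mul0r.
have /choice[b vel] i : exists b, forall t, I t ->
    derive1n 1 a t 0 (lshift 1 i) = b.
  have [t It|b vel] := antiderivative_unique Iitv I0
    (fun t It => da 1 t It (lshift 1 i)) _ (g := cst 0).
    by rewrite acc //; exact: is_derive_cst.
  by exists b => t It; rewrite vel // add0r.
have /choice[d pos] i : exists d, forall t, I t ->
    a t 0 (lshift 1 i) = b i * t + d.
  apply: antiderivative_unique Iitv I0 (fun t It => da 0 t It (lshift 1 i)) _.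
  move=> t It; rewrite vel //.
  by have := is_derive_fZ (b i) (is_derive_id t (1 : R)); rewrite mulr1.
have [t It|k Hz] := antiderivative_unique Iitv I0
    (fun t It => da 0 t It iz) _
    (g := fun t => 2 * t * cos theta + \sum_(i < n)
       b (lshift n i) * (b (rshift n i) / 2 * t ^+ 2 + d (rshift n i) * t)).
  have [_ _ -> _] := sys t It; apply: is_derive_height => i.
  rewrite /ix /iy vel // pos // [X in is_derive _ _ _ X]mulrC.
  exact: is_derive_fZ (is_derive_parabola _ _ _).
pose c j := row_mx (\row_i b i) (const_mx k : 'rV_1) 0 j.
have cE i : c (lshift 1 i) = b i by rewrite /c row_mxEl mxE.
have ckE : c iz = k by rewrite /c row_mxEr mxE.
exists c, d; split.
  have [t0 It0] := I0; have [_ _ _ <-] := sys t0 It0.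
  rewrite big_split_ord /= -big_split; apply: eq_bigr => i _ /=.
  by rewrite !cE /ix /iy !vel.
move=> t It; split=> [i|]; first by rewrite cE pos.
by rewrite ckE; under eq_bigr do rewrite /ix /iy !cE; exact: Hz.
Qed.

Lemma parabola_system theta c d :
  \sum_(i < n + n) c (lshift 1 i) ^+ 2 = 4 * sin theta ^+ 2 ->
  parabola theta c d -> smooth_on I a /\ magnetic_system I a 0 theta.
Proof.
move=> c2 par.
have eh i t : I t -> derive1n 0 a t 0 (lshift 1 i) = c (lshift 1 i) * t + d i.
  by case/par.
have ez t : I t -> derive1n 0 a t 0 iz = 2 * t * cos theta
    + \sum_(i < n) c (ix i) * (c (iy i) / 2 * t ^+ 2 + d (rshift n i) * t)
    + c iz.
  by case/par.
have sa : smooth_on I a.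
  apply: smooth_on_elementary => //; apply: coord_ind => [i|i|].
  - by eexists; last exact: eh; elem.
  - by eexists; last exact: eh; elem.
  eexists; last exact: ez; under eq_fun do under eq_bigr do rewrite expr2.
  by elem.
split=> //.
have vel i : forall t, I t -> derive1n 1 a t 0 (lshift 1 i) = c (lshift 1 i).
  by apply: derive1n_coord (eh i) _ => // t It; exact: is_derive_affine.
have acc i : forall t, I t -> derive1n 2 a t 0 (lshift 1 i) = 0.
  by apply: derive1n_coord (vel i) _ => // t It; exact: is_derive_cst.
have vz : forall t, I t -> derive1n 1 a t 0 iz
    = 2 * cos theta + \sum_(i < n) c (ix i) * (c (iy i) * t + d (rshift n i)).
  apply: derive1n_coord ez _ => // t It.
  apply: is_derive_Dcst; apply: is_derive_height => i.
  exact: is_derive_fZ (is_derive_parabola _ _ _).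
move=> t It; split=> [i|i||].
- by rewrite [LHS]acc // oppr0 mul0r.
- by rewrite [LHS]acc // mul0r.
- by rewrite vz //; congr (_ + _); apply: eq_bigr => i _;
    rewrite /ix vel // -eh // mulrC.
rewrite -c2 big_split_ord /= -big_split; apply: eq_bigr => i _ /=.
by rewrite /ix /iy !vel.
Qed.

End Classification.

(** * The classification *)

(* The implication from left to right is the classification; the converse is
   the assertion that the constants are arbitrary, up to the constraints. *)
Theorem theorem3 (R : realType) (n : nat) (q : R) (hq : q != 0)
    (I : set R) (Iopen : open I) (Iitv : is_interval I) (I0 : I !=set0)
    (alpha : R -> 'rV[R]_(n + n + 1))
    (theta : R) (htheta : 0 <= theta <= pi) :
  (pseudo_hermitian_magnetic q I alpha /\ contact_angle I alpha theta)
  <->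
  ((exists lambda : R, lambda = q - 2 * cos theta /\ lambda != 0 /\
    exists (c d : 'I_n -> R) (h : 'I_(n + n + 1) -> R),
      \sum_(i < n) c i ^+ 2 = 4 * sin theta ^+ 2 /\
      forall t, I t ->
        (forall i : 'I_n,
           alpha t 0 (ix i) = c i / lambda * sin (lambda * t + d i) + h (ix i)) /\
        (forall i : 'I_n,
           alpha t 0 (iy i) = - c i / lambda * cos (lambda * t + d i) + h (iy i)) /\
        alpha t 0 iz =
          2 * t * cos theta
          + \sum_(i < n)
              (- c i ^+ 2 / (4 * lambda ^+ 2)
                 * (2 * (lambda * t + d i) + sin (2 * (lambda * t + d i)))
               + c i * h (iy i) / lambda * sin (lambda * t + d i))
          + h iz)
   \/
   (q = 2 * cos theta /\
    exists (c : 'I_(n + n + 1) -> R) (d : 'I_(n + n) -> R),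
      q ^+ 2 + \sum_(i < n + n) c (lshift 1 i) ^+ 2 = 4 /\
      forall t, I t ->
        (forall i : 'I_(n + n),
           alpha t 0 (lshift 1 i) = c (lshift 1 i) * t + d i) /\
        alpha t 0 iz =
          2 * t * cos theta
          + \sum_(i < n)
              c (ix i) * (c (iy i) / 2 * t ^+ 2 + d (rshift n i) * t)
          + c iz)).
Proof.
(* For q = 2 cos theta the two normalizations of the constants coincide. *)
have sumE (x : R) : q = 2 * cos theta ->
    q ^+ 2 + x = 4 <-> x = 4 * sin theta ^+ 2.
  by move=> ->; have := cos2Dsin2 theta; rewrite exprMn; split; lra.
split=> [[mag ca]|].
  have sa : smooth_on I alpha by case: mag.
  have sys : magnetic_system I alpha (q - 2 * cos theta) theta.
    exact/magnetic_systemP.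
  have [l0|l0] := eqVneq (q - 2 * cos theta) 0.
    right; move: (l0) => /subr0_eq qE; split=> //; rewrite l0 in sys.
    have [c [d [c2 par]]] := system_parabola Iitv I0 sa sys.
    by exists c, d; split=> //; apply/sumE.
  left; exists (q - 2 * cos theta); split=> //; split=> //.
  have [c [d [h [c2 hel]]]] := system_helix Iitv I0 l0 sa sys.
  by exists c, d, h; split=> // t /hel[].
move=> [[l [lE [l0 [c [d [h [c2 hel]]]]]]]|[qE [c [d [c2 par]]]]].
  have [|sa] := helix_system Iopen l0 c2 (a := alpha) (d := d) (h := h).
    by move=> t /hel[? []].
  by rewrite lE => sys; apply/magnetic_systemP.
have [|sa sys] := parabola_system Iopen (a := alpha) (d := d)
  ((sumE _ qE).1 c2).
  exact: par.
by apply/magnetic_systemP; rewrite // qE subrr.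
Qed.
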